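(* Every circle is a spherical Pasch space whose boundary at infinity (at each of its points) consists of two points.
   Context: A betweenness relation on a set $\Pi$ is a ternary relation ''$C$ is between $A$ and $B$'' such that, writing $s[A,B]$ for the set of all points between $A$ and $B$: (a) each point is between itself and any point of $\Pi$; (b) if $A$ is between $B$ and $C$, then $A$ is between $C$ and $B$; (c) if $C\in s[A,B]$, then $s[A,B]=s[A,C]\cup s[C,B]$ and $s[A,C]\cap s[C,B]=s[C,C]=\{C\}$. A closed line segment is a set of the form $s[A,B]$; its interior is $s(A,B)=s[A,B]\setminus\{A,B\}$. A subset $S$ is convex if $s[A,B]\subset S$ for all $A,B\in S$. A closed line segment is connected if, whenever it is expressed as a union of two disjoint non-empty convex subsets, precisely one of them is a closed line segment. A line is a set $l$ with a betweenness relation, consisting of at least two points, such that for every $A\in l$ the complement $l\setminus\{A\}$ is the union of two disjoint non-empty convex sets $c_1,c_2$ with $A\in s[B,C]$ whenever $B\in c_1$, $C\in c_2$. A circle is a set $c$ with a betweenness relation such that: $c$ contains at least three points; each $A\in c$ has an antipodal point $a(A)$ such that $s[A,a(A)]$ contains exactly two points; $s[A,B]$ is connected if $A$ is not antipodal to $B$; for each $A\in c$ the complement $c\setminus\{A,a(A)\}$ is the union of two disjoint non-empty convex sets $l_1,l_2$ that are lines with the betweenness inherited from $c$. A ray emanating from $A$ is a convex set $r$ such that: $A\in r$ but $A$ is not between any two other points of $r$; every three points of $r$ are contained in a closed line segment which is a subset of $r$; $r$ is not equal to any closed line segment. It is maximal if it is not a proper subset of another ray emanating from $A$, and connected if the closed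 line segments contained in it are connected. A space with maximal rays is a set with betweenness such that (1) if $s[A,B]$ and $s[A,C]$ have a common interior point, then one of them is contained in the other; (2) if $A\neq B$ and $s[A,B]$ is connected, then there is a connected $s[C,D]$ with $s[A,B]\subset s(C,D)$. Two maximal rays $r_1,r_2$ emanating from the same point $A$ are antipodal if there are $B\in r_1$, $C\in r_2$ with $A\in s(B,C)$. The boundary at infinity $\partial(\Pi,A)$ is the set of connected maximal rays emanating from $A$. A Pasch space is a space $\Pi$ with maximal rays satisfying the Pasch Condition: for every $A\in\Pi$ and every subset $\{r_1,r_2,r_3\}$ of $\partial(\Pi,A)$ disjoint from the set of its antipodal rays, and all points $B,C\in r_1\setminus\{A\}$ and $D\in r_3\setminus\{A\}$, if $r_2$ intersects $s[B,D]$ then $r_2$ intersects $s[C,D]$. A spherical Pasch space is a Pasch space equipped with a map $a:\Pi\to\Pi$ (the antipodal map) with $a^2=\mathrm{id}$, $a(B)\neq B$ for all $B$, and $a(s[B,C])=s[a(B),a(C)]$ for all $B,C$, such that: for non-antipodal points $A,B$ (i.e. $B\neq a(A)$) $s[A,B]$ is connected; $s[A,B]$ consists of exactly two points if $a(B)=A$; and if $r_1,r_2$ are maximal rays emanating from the same point and $r_1\cup r_2$ contains a pair of antipodal points, then $r_1$ and $r_2$ are antipodal rays. A circle is regarded as equipped with its map $A\mapsto a(A)$. *)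

(* Defs.v *)
From mathcomp Require Import all_boot.
From mathcomp Require Import boolp classical_sets.

Set Implicit Arguments.
Unset Strict Implicit.
Unset Printing Implicit Defensive.

Local Open Scope classical_set_scope.

(* [s A B] is the set s[A,B] of all points between A and B. *)
Record betweenness (T : Type) := Betweenness {
  seg :> T -> T -> set T;
  seg_endl : forall A B, seg A B A;
  seg_sym : forall A B C, seg B C A -> seg C B A;
  seg_split : forall A B C, seg A B C ->
    [/\ seg A B = seg A C `|` seg C B,
        seg A C `&` seg C B = seg C C
      & seg C C = [set C]]
}.

Definition at_least_two (T : Type) (S : set T) : Prop :=
  exists x y, [/\ S x, S y & x <> y].

Definition at_least_three (T : Type) (S : set T) : Prop :=
  exists x y z, [/\ S x, S y & S z] /\ [/\ x <> y, x <> z & y <> z].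

Definition exactly_two (T : Type) (S : set T) : Prop :=
  exists x y, x <> y /\ S = [set x; y].

Definition seg_interior (T : Type) (s : betweenness T) (A B : T) : set T :=
  s A B `\` [set A; B].

Definition is_segment (T : Type) (s : betweenness T) (S : set T) : Prop :=
  exists A B, S = s A B.

Definition convex (T : Type) (s : betweenness T) (S : set T) : Prop :=
  forall A B, S A -> S B -> s A B `<=` S.

(* [S] is expressed as a union of two disjoint non-empty convex subsets. *)
Definition convex_split (T : Type) (s : betweenness T) (S c1 c2 : set T) :
    Prop :=
  [/\ S = c1 `|` c2, c1 `&` c2 = set0, c1 !=set0 /\ c2 !=set0
    & convex s c1 /\ convex s c2].

(* Only used for closed line segments [S]. *)
Definition connected_segment (T : Type) (s : betweenness T) (S : set T) :
    Prop :=
  forall c1 c2, convex_split s S c1 c2 ->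
    (is_segment s c1 /\ ~ is_segment s c2) \/
    (~ is_segment s c1 /\ is_segment s c2).

Definition inherited_seg (T : Type) (s : betweenness T) (D : set T)
    (A B : D) : set D :=
  [set C | s (val A) (val B) (val C)].

Lemma inherited_seg_endl (T : Type) (s : betweenness T) (D : set T)
    (A B : D) : inherited_seg s A B A.
Proof. exact: seg_endl. Qed.

Lemma inherited_seg_sym (T : Type) (s : betweenness T) (D : set T)
    (A B C : D) : inherited_seg s B C A -> inherited_seg s C B A.
Proof. exact: seg_sym. Qed.

Lemma inherited_seg_split (T : Type) (s : betweenness T) (D : set T)
    (A B C : D) : inherited_seg s A B C ->
  [/\ inherited_seg s A B = inherited_seg s A C `|` inherited_seg s C B,
      inherited_seg s A C `&` inherited_seg s C B = inherited_seg s C C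
    & inherited_seg s C C = [set C]].
Proof.
rewrite /inherited_seg => sC; have [sAB sI sCC] := seg_split sC; split.
- by rewrite sAB.
- by rewrite -sI.
- rewrite sCC; apply/seteqP; split=> P /= => [/val_inj //|-> //].
Qed.

Definition inherited (T : Type) (s : betweenness T) (D : set T) :
    betweenness D :=
  Betweenness (@inherited_seg_endl T s D) (@inherited_seg_sym T s D)
              (@inherited_seg_split T s D).

Record is_line (T : Type) (s : betweenness T) : Prop := IsLine {
  line_card : at_least_two [set: T];
  line_split : forall A : T, exists c1 c2 : set T,
    convex_split s (~` [set A]) c1 c2 /\
    forall B C, c1 B -> c2 C -> s B C A
}.

Record is_circle (T : Type) (s : betweenness T) (a : T -> T) : Prop :=
IsCircle {
  circle_card : at_least_three [set: T];
  circle_antipodal : forall A, exactly_two (s A (a A));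
  circle_connected : forall A B, B <> a A -> connected_segment s (s A B);
  circle_split : forall A, exists l1 l2 : set T,
    [/\ convex_split s (~` [set A; a A]) l1 l2,
        is_line (inherited s l1) & is_line (inherited s l2)]
}.

Record is_ray (T : Type) (s : betweenness T) (A : T) (r : set T) : Prop :=
IsRay {
  ray_convex : convex s r;
  ray_origin : r A;
  ray_extreme : forall B C, r B -> r C -> B <> A -> C <> A -> ~ s B C A;
  ray_three : forall P Q R, r P -> r Q -> r R ->
    exists C D, [set P; Q; R] `<=` s C D /\ s C D `<=` r;
  ray_not_segment : ~ is_segment s r
}.

Definition is_maximal_ray (T : Type) (s : betweenness T) (A : T)
    (r : set T) : Prop :=
  is_ray s A r /\ forall r', is_ray s A r' -> ~ (r `<` r').

Definition connected_ray (T : Type) (s : betweenness T) (r : set T) : Prop :=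
  forall A B, s A B `<=` r -> connected_segment s (s A B).

Record has_maximal_rays (T : Type) (s : betweenness T) : Prop :=
HasMaximalRays {
  common_interior : forall A B C,
    seg_interior s A B `&` seg_interior s A C !=set0 ->
    s A B `<=` s A C \/ s A C `<=` s A B;
  segment_extension : forall A B, A <> B -> connected_segment s (s A B) ->
    exists C D, connected_segment s (s C D) /\ s A B `<=` seg_interior s C D
}.

Definition antipodal_rays (T : Type) (s : betweenness T) (A : T)
    (r1 r2 : set T) : Prop :=
  [/\ is_maximal_ray s A r1, is_maximal_ray s A r2
    & exists B C, [/\ r1 B, r2 C & seg_interior s B C A]].

Definition boundary_at_infinity (T : Type) (s : betweenness T) (A : T) :
    set (set T) :=
  [set r | is_maximal_ray s A r /\ connected_ray s r].

(* The rays r1, r2, r3 are not required to be distinct. *)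
Definition pasch_condition (T : Type) (s : betweenness T) : Prop :=
  forall (A : T) (r1 r2 r3 : set T),
    [set r1; r2; r3] `<=` boundary_at_infinity s A ->
    [set r1; r2; r3] `&`
      [set r' | exists2 r, [set r1; r2; r3] r & antipodal_rays s A r r']
      = set0 ->
  forall B C D, (r1 `\ A) B -> (r1 `\ A) C -> (r3 `\ A) D ->
    r2 `&` s B D !=set0 -> r2 `&` s C D !=set0.

Definition is_pasch_space (T : Type) (s : betweenness T) : Prop :=
  has_maximal_rays s /\ pasch_condition s.

Record is_spherical_pasch_space (T : Type) (s : betweenness T) (a : T -> T) :
    Prop := IsSphericalPaschSpace {
  spherical_pasch : is_pasch_space s;
  spherical_invol : forall B, a (a B) = B;
  spherical_nofix : forall B, a B <> B;
  spherical_image : forall B C, a @` s B C = s (a B) (a C);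
  spherical_connected : forall A B, B <> a A -> connected_segment s (s A B);
  spherical_antipodal : forall A B, a B = A -> exactly_two (s A B);
  spherical_rays : forall A r1 r2,
    is_maximal_ray s A r1 -> is_maximal_ray s A r2 ->
    (exists B, (r1 `|` r2) B /\ (r1 `|` r2) (a B)) ->
    antipodal_rays s A r1 r2
}.

(* Main.v *)
(* The complement of a point A and its antipode splits into two sides l, l'.
   Connectedness makes each side a linearly ordered continuum and forbids two
   distinct points from closing the same half-open segment.  The heart of the
   matter is that the circle does not branch: two initial pieces of segments
   issuing from M into the same side of M overlap ([germs_meet]), hence no three
   segments issuing from M are pairwise disjoint away from M.  It follows that a
   segment joining l to l' passes through A or a A, so that the segments from A
   to the points of l stay in l and are nested.  The maximal rays from A are
   then exactly A |` l and A |` l', and they are antipodal. *)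

Require Import Defs.
From mathcomp Require Import all_boot.
From mathcomp Require Import boolp classical_sets.

Local Open Scope classical_set_scope.

(** * The order on a closed segment *)

Section Betweenness.
Set Implicit Arguments.
Unset Strict Implicit.
Variables (T : Type) (s : betweenness T).
Implicit Types (A B C D E M N P X Y Z : T) (l : set T).

Lemma segC A B : s A B = s B A.
Proof. by apply/seteqP; split=> C; exact: seg_sym. Qed.

Lemma seg_endr A B : s A B B.
Proof. by rewrite segC; exact: seg_endl. Qed.

Lemma seg_diag A : s A A = [set A].
Proof. by case: (seg_split (seg_endl s A A)). Qed.

Lemma seg_cases A B C D : s A B C -> s A B D -> s A C D \/ s C B D.
Proof. by move=> h; case: (seg_split h) => -> _ _. Qed.

Lemma seg_subl A B C D : s A B C -> s A C D -> s A B D.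
Proof. by move=> h; case: (seg_split h) => -> _ _; left. Qed.

Lemma seg_subr A B C D : s A B C -> s C B D -> s A B D.
Proof. by move=> h; case: (seg_split h) => -> _ _; right. Qed.

Lemma seg_meet A B C D : s A B C -> s A C D -> s C B D -> D = C.
Proof.
move=> h AD BD; have [_ e e1] := seg_split h.
have : (s A C `&` s C B) D by [].
by rewrite e e1.
Qed.

Lemma seg_anti A C D : s A C D -> s A D C -> C = D.
Proof. by move=> hD hC; apply: (seg_meet hD hC); exact: seg_endr. Qed.

Lemma seg_nest A B C D : s A B C -> s A C D -> s D B C.
Proof.
move=> ABC ACD; have ABD := seg_subl ABC ACD.
case: (seg_cases ABD ABC) => // ADC.
by rewrite (seg_anti ACD ADC); exact: seg_endl.
Qed.

Lemma seg_total A B C D : s A B C -> s A B D -> s A C D \/ s A D C.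
Proof.
move=> ABC ABD; case: (seg_cases ABC ABD) => [|CBD]; first by left.
by right; rewrite segC; apply: (@seg_nest B); rewrite segC.
Qed.

Lemma convex_seg A B : convex s (s A B).
Proof.
move=> C D; wlog ACD : C D / s A C D.
  move=> wl ABC ABD; case: (seg_total ABC ABD) => h; first exact: wl.
  by rewrite segC; exact: wl.
move=> ABC ABD E CDE; apply: (seg_subl ABC); apply: (seg_subr ACD).
by rewrite segC.
Qed.

Lemma convexI (S1 S2 : set T) :
  convex s S1 -> convex s S2 -> convex s (S1 `&` S2).
Proof.
by move=> h1 h2 A B [A1 A2] [B1 B2] C ABC; split; [exact: (h1 A B)|exact: (h2 A B)].
Qed.

(** Of the two ends of [S], the one nearer to [A] must be [A] itself. This turns the assumption of
    being a closed segment into a last point [M]. *)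
Lemma subsegment_endl A B (S : set T) :
  S A -> S `<=` s A B -> is_segment s S -> exists2 M, S M & S = s A M.
Proof.
move=> SA SAB [C [D SCD]]; wlog ACD : C D SCD / s A C D.
  have SC : S C by rewrite SCD; exact: seg_endl.
  have SD : S D by rewrite SCD; exact: seg_endr.
  move=> wl; case: (seg_total (SAB _ SC) (SAB _ SD)) => h; first exact: wl SCD h.
  by apply: wl h; rewrite SCD segC.
exists C; first by rewrite SCD; exact: seg_endl.
suff -> : A = D by rewrite SCD segC.
move: SA; rewrite SCD segC => DCA.
move: ACD; rewrite segC => CAD; apply: (@seg_anti C) => //.
by rewrite segC.
Qed.

(** * Lines inside an ambient space *)

Definition line_set l := convex s l /\ is_line (inherited s l).

(** The two convex pieces of [l] without [A] are recorded by a single set [c] and its complement, so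
    that betweenness at [A] becomes propositional reasoning. Convexity of the pieces gives the
    implication from left to right, the line axiom its converse. *)
Lemma line_cut l A : line_set l -> l A -> exists c : set T,
  [/\ forall B C, l B -> l C -> B <> A -> C <> A -> (s B C A <-> ~ (c B <-> c C)),
      exists2 B, l B & B <> A /\ c B
    & exists2 C, l C & C <> A /\ ~ c C].
Proof.
move=> [lc [_ hl]] lA.
have [c1 [c2 [[eU eI [[B c1B] [C c2C]] [v1 v2]] bt]]] := hl (exist _ A (mem_set lA)).
have val_neq (x : l) : (c1 `|` c2) x -> val x <> A.
  by rewrite -eU => h e; apply: h; exact: val_inj.
have disj x : c1 x -> ~ c2 x.
  by move=> h1 h2; have : (c1 `&` c2) x by []; rewrite eI.
have notA x : (c1 `|` c2) x -> x <> exist _ A (mem_set lA).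
  by rewrite -eU.
exists [set x | exists2 y : l, val y = x & c1 y]; split.
- move=> P Q lP lQ PA QA.
  pose p : l := exist _ P (mem_set lP); pose q : l := exist _ Q (mem_set lQ).
  have [pU qU] : (c1 `|` c2) p /\ (c1 `|` c2) q.
    by rewrite -eU; split=> -[].
  have cP (y : l) : (exists2 z : l, val z = val y & c1 z) <-> c1 y.
    by split=> [[z /val_inj ->]|]; last by exists y.
  rewrite /= -[P]/(val p) -[Q]/(val q) 2!cP.
  split=> [pqA h|h].
    case: pU => [p1|p2].
      have q1 := (proj1 h p1).
      by have /(_ (or_introl _)) := @notA _ _ erefl; apply; exact: (v1 p q).
    case: qU => [q1|q2]; first by case: (@disj p) => //; apply/h.
    by have /(_ (or_intror _)) := @notA _ _ erefl; apply; exact: (v2 p q).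
  case: pU => [p1|p2]; case: qU => [q1|q2].
  + by case: h.
  + exact: (bt p q).
  + by rewrite segC; exact: (bt q p).
  + by case: h; split=> h; [case: (@disj p)|case: (@disj q)].
- exists (val B); first exact/set_mem/valP.
  by split; [apply: val_neq; left|exists B].
- exists (val C); first exact/set_mem/valP.
  split; first by apply: val_neq; right.
  by move=> [y /val_inj -> c1C]; exact: (@disj C).
Qed.

(** Of any three points, two lie in the same piece of the cut at [A]. *)
Lemma line_cut3 l A B C D : line_set l -> l A -> l B -> l C -> l D ->
  B <> A -> C <> A -> D <> A -> s B C A -> s B D A -> s C D A -> False.
Proof.
move=> ll lA lB lC lD BA CA DA; have [c [h _ _]] := line_cut ll lA.
by rewrite !h //; tauto.
Qed.

Lemma line_cut_or l A B C D : line_set l -> l A -> l B -> l C -> l D ->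
  B <> A -> C <> A -> D <> A -> s B C A -> s B D A \/ s C D A.
Proof.
move=> ll lA lB lC lD BA CA DA; have [c [h _ _]] := line_cut ll lA.
by rewrite !h //; have := EM (c B); have := EM (c C); have := EM (c D); tauto.
Qed.

Lemma line_between l A : line_set l -> l A ->
  exists P Q, [/\ l P, l Q & [/\ P <> A, Q <> A & s P Q A]].
Proof.
move=> ll lA; have [c [h [B lB [BA cB]] [C lC [CA cC]]]] := line_cut ll lA.
by exists B, C; split=> //; split=> //; rewrite h //; tauto.
Qed.

Lemma line_extend l A B : line_set l -> l A -> l B -> B <> A ->
  exists C, [/\ l C, C <> A & s B C A].
Proof.
move=> ll lA lB BA; have [P [Q [lP lQ [PA QA PQA]]]] := line_between ll lA.
case: (line_cut_or ll lA lP lQ lB) => // h; [exists P|exists Q]; split=> //.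
  by rewrite segC.
by rewrite segC.
Qed.

(* If none of [X, Y, Z] were between the others, each of the three segments
   would be the disjoint union of its intersections with the other two, and
   connectedness would make exactly one of any two of the three pairwise
   intersections a closed segment. *)
Lemma line_trichotomy l X Y Z : line_set l ->
  (forall P Q, l P -> l Q -> connected_segment s (s P Q)) ->
  l X -> l Y -> l Z -> [\/ s X Y Z, s X Z Y | s Y Z X].
Proof.
move=> ll conn lX lY lZ; apply: contrapT => none.
have nZ : ~ s X Y Z by move=> h; apply: none; constructor 1.
have nY : ~ s X Z Y by move=> h; apply: none; constructor 2.
have nX : ~ s Y Z X by move=> h; apply: none; constructor 3.
have key U V W : l U -> l V -> l W -> ~ s U V W -> ~ s U W V -> ~ s V W U ->
    convex_split s (s U V) (s U V `&` s U W) (s U V `&` s V W).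
  move=> lU lV lW nW nV nU; split.
  - apply/seteqP; split=> [M UVM|M [[]|[]] //].
    have [->|MU] := pselect (M = U).
      by left; split; exact: seg_endl.
    have [->|MV] := pselect (M = V).
      by right; split; [exact: seg_endr|exact: seg_endl].
    have MW : W <> M by move=> e; apply: nW; rewrite e.
    have lM : l M by apply: ll.1 UVM.
    by case: (line_cut_or ll lM lU lV lW _ _ MW UVM); [exact/nesym|exact/nesym|left|right].
  - apply/seteqP; split=> // M [[UVM UWM] [_ VWM]].
    have lM : l M by apply: ll.1 UVM.
    by apply: (line_cut3 ll lM lU lV lW _ _ _ UVM UWM VWM) => e; subst M.
  - by split; [exists U|exists V]; split;
      (exact: seg_endl || exact: seg_endr).
  - by split; apply: convexI; exact: convex_seg.
have h1 := conn _ _ lX lY _ _ (key _ _ _ lX lY lZ nZ nY nX).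
have h2 := conn _ _ lX lZ _ _ (key _ _ _ lX lZ lY nY nZ ltac:(by rewrite segC)).
have h3 := conn _ _ lY lZ _ _ (key _ _ _ lY lZ lX nX ltac:(by rewrite segC) ltac:(by rewrite segC)).
move: h1 h2 h3; rewrite (segC Y X) (segC Z X) (segC Z Y).
rewrite (setIC (s X Z) (s X Y)) (setIC (s Y Z) (s X Y)) (setIC (s Y Z) (s X Z)).
tauto.
Qed.

End Betweenness.

(** * Antipodes and density on a circle *)

Section Circle.
Set Implicit Arguments.
Unset Strict Implicit.
Variables (T : Type) (s : betweenness T) (a : T -> T).
Hypothesis hc : is_circle s a.
Implicit Types (A B C D E M N P X Y Z : T) (l : set T).

Lemma antipode_neq A : a A <> A.
Proof.
move=> e; have [x [y [xy]]] := circle_antipodal hc A.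
rewrite e seg_diag => exy; apply: xy.
have h z : [set x; y] z -> z = A by rewrite -exy.
have -> : x = A by apply: h; left.
by symmetry; apply: h; right.
Qed.

Lemma seg_antipode A X : s A (a A) X -> X = A \/ X = a A.
Proof.
have [x [y [xy exy]]] := circle_antipodal hc A.
have := seg_endl s A (a A); have := seg_endr s A (a A).
have := @antipode_neq A.
rewrite exy /= => h [e|e] [e'|e'] [f|f]; rewrite f -?e -?e'; by [left|right|case: h; rewrite e e'].
Qed.

(** A gap with ends [C] and [D] would split [s A B] into two closed segments, which connectedness
    forbids. *)
Lemma seg_dense A B C D : B <> a A -> s A B C -> s A B D -> C <> D ->
  exists E, [/\ s C D E, E <> C & E <> D].
Proof.
move=> BA; wlog ADC : C D / s A D C.
  move=> wl hC hD CD; case: (seg_total hC hD) => h.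
    have [E [h1 h2 h3]] := wl _ _ h hD hC (nesym CD).
    by exists E; split=> //; rewrite segC.
  exact: wl.
move=> hC hD CD; apply: contrapT => nE.
have gap E : s C D E -> E = C \/ E = D.
  by move=> h; apply: contrapT => /not_orP[h1 h2]; apply: nE; exists E.
have DBC : ~ s D B C.
  by move=> h; apply: CD; exact: seg_meet hD ADC h.
have split_ACDB : convex_split s (s A B) (s A C) (s D B).
  split.
  - apply/seteqP; split=> [E hE|E [h|h]].
    + case: (seg_cases hD hE) => [ADE|]; last by right.
      case: (seg_cases ADC ADE) => [|/gap[->|->]]; first by left.
        by left; exact: seg_endr.
      by right; exact: seg_endl.
    + exact: seg_subl hC h.
    + exact: seg_subr hD h.
  - apply/seteqP; split=> // E [ACE DBE].
    have e := seg_meet hD (seg_subl ADC ACE) DBE.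
    by apply: CD; apply: (@seg_anti _ s A) => //; rewrite -e.
  - by split; [exists A|exists D]; exact: seg_endl.
  - by split; exact: convex_seg.
have h1 : is_segment s (s A C) by exists A, C.
have h2 : is_segment s (s D B) by exists D, B.
by have := circle_connected hc BA split_ACDB; tauto.
Qed.

(** Otherwise the segment from [a A] to [A] would be dense, although it has only two points. *)
Lemma antipodeK A : a (a A) = A.
Proof.
apply: contrapT => h.
have [E [h1 h2 h3]] := seg_dense (nesym h) (seg_endl s _ _) (seg_endr s _ _)
  (@antipode_neq A).
by move: h1; rewrite segC => /seg_antipode[].
Qed.

Lemma seg_no_antipodes A B C : B <> a A -> s A B C -> ~ s A B (a C).
Proof.
move=> BA h h'.
have [E [/seg_antipode[]]] := seg_dense BA h h' (nesym (@antipode_neq C)).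
  by [].
by [].
Qed.

(** Prolonging the segment from [a X] to [X] beyond [X] gives a segment with non-antipodal ends that
    contains an antipodal pair. *)
Lemma line_no_antipodes l X : line_set s l -> l X -> ~ l (a X).
Proof.
move=> ll lX laX; have [C [lC CX h]] := line_extend ll lX laX (@antipode_neq X).
have Ca : C <> a (a X) by rewrite antipodeK.
apply: seg_no_antipodes Ca h _; exact: seg_endl.
Qed.

Lemma line_neq_antipode l X Y : line_set s l -> l X -> l Y -> Y <> a X.
Proof. by move=> ll lX lY e; apply: (line_no_antipodes ll lX); rewrite -e. Qed.

Lemma line_tri l X Y Z : line_set s l -> l X -> l Y -> l Z ->
  [\/ s X Y Z, s X Z Y | s Y Z X].
Proof.
move=> ll; apply: (line_trichotomy ll) => P Q lP lQ.
by apply: (circle_connected hc); exact: line_neq_antipode lP lQ.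
Qed.

(** * The two sides of a point and its antipode *)

Definition sides A l l' :=
  [/\ convex_split s (~` [set A; a A]) l l', line_set s l & line_set s l'].

Lemma sides_exist A : exists l l', sides A l l'.
Proof.
have [l [l' [h h1 h2]]] := circle_split hc A; exists l, l'.
by case: (h) => _ _ _ [c1 c2]; split.
Qed.

Section Sides.
Variables (A : T) (l l' : set T).
Hypothesis hl : sides A l l'.

Lemma sidesC : sides A l' l.
Proof.
by case: hl => -[h1 h2 [h3 h4] [h5 h6]] h7 h8; split=> //; split=> //;
  rewrite ?(setUC l') ?(setIC l').
Qed.

Lemma sides_line : line_set s l. Proof. by case: hl. Qed.

Lemma sidesP X : X <> A -> X <> a A -> l X \/ l' X.
Proof.
case: hl => -[e _ _ _] _ _ h1 h2.
have : (~` [set A; a A]) X by move=> [].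
by rewrite e.
Qed.

Lemma side_neq X : l X -> X <> A.
Proof.
case: hl => -[e _ _ _] _ _ lX eX.
have : (l `|` l') X by left.
by rewrite -e; apply; left.
Qed.

Lemma side_neq_antipode X : l X -> X <> a A.
Proof.
case: hl => -[e _ _ _] _ _ lX eX.
have : (l `|` l') X by left.
by rewrite -e; apply; right.
Qed.

Lemma side_disj X : l X -> ~ l' X.
Proof.
by case: hl => -[_ e _ _] _ _ h1 h2; have : (l `&` l') X by []; rewrite e.
Qed.

Lemma side_convex X Y Z : l X -> l Y -> s X Y Z -> l Z.
Proof. by move=> h1 h2; apply: sides_line.1. Qed.

Lemma side_antipode X : l X -> l' (a X).
Proof.
move=> lX; case: (@sidesP (a X)) => //.
- by move=> e; apply: (side_neq_antipode lX); rewrite -e antipodeK.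
- by move=> e; apply: (side_neq lX); rewrite -(antipodeK X) e antipodeK.
- by move=> h; case: (line_no_antipodes sides_line lX).
Qed.

End Sides.

(** * Open ends and germs of segments *)

(** Cut at an interior point [A]: both [M] and [N] lie on the side away from [P], which is a line.
    Take [A'] on the common half-open segment beyond [A]. If [M] or [N] is between [A'] and the
    other, it belongs to the half-open segment that it closes; if [A'] is between [M] and [N],
    points just beyond [A'] would lie on both sides of [A']. *)
Lemma open_end_unique P M N : M <> a P -> N <> a P -> P <> M -> P <> N ->
  (forall C, (s P M C /\ C <> M) <-> (s P N C /\ C <> N)) -> M = N.
Proof.
move=> Ma Na PM PN eqMN; apply: contrapT => MN.
have [A [PMA AP AM]] := seg_dense Ma (seg_endl s _ _) (seg_endr s _ _) PM.
have [PNA AN] : s P N A /\ A <> N by apply/eqMN.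
have AaP : P <> a A.
  move=> e; apply: (seg_no_antipodes Ma PMA); rewrite -e; exact: seg_endl.
have sep l l' X : X <> a P -> P <> X -> s P X A -> X <> A -> sides A l l' -> l P -> l' X.
  move=> Xa PX PXA XA hl lP; case: (@sidesP _ _ _ hl X) => //.
    move=> e; apply: (seg_no_antipodes Xa PXA); rewrite -e; exact: seg_endr.
  by move=> lX; case: (side_neq hl (side_convex hl lP lX PXA)).
have [l [l' [hl lP]]] : exists l l', sides A l l' /\ l P.
  have [l [l' hl]] := sides_exist A.
  case: (sidesP hl (nesym AP) AaP) => h; first by exists l, l'.
  by exists l', l; split=> //; exact: sidesC.
have l'M : l' M by apply: sep hl lP => //; exact: nesym.
have l'N : l' N by apply: sep hl lP => //; exact: nesym.
have [A' [hA' A'A A'M]] := seg_dense Ma PMA (seg_endr s _ _) AM.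
have PMA' : s P M A' by apply: seg_subr hA'.
have [PNA' A'N] : s P N A' /\ A' <> N by apply/eqMN.
have PA'A : s P A' A.
  case: (seg_total PMA PMA') => // PAA'.
  by case: A'A; exact: seg_meet PMA PAA' hA'.
suff lA' : l A' by case: (side_neq hl (side_convex hl lP lA' PA'A)).
case: (@sidesP _ _ _ hl A') => //.
  by move=> e; apply: (seg_no_antipodes Ma PMA); rewrite -e.
move=> l'A'.
case: (line_tri (sides_line (sidesC hl)) l'A' l'M l'N) => h.
- have : s P M N /\ N <> M by split; [exact: seg_subr h|exact: nesym].
  by move=> /eqMN[].
- have : s P N M /\ M <> N by split=> //; exact: seg_subr h.
  by move=> /eqMN[].
- have [E [A'ME EA' EM]] := seg_dense Ma PMA' (seg_endr s _ _) A'M.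
  have [PNE EN] : s P N E /\ E <> N by apply/eqMN; split=> //; exact: seg_subr A'ME.
  case: (seg_cases PNA' PNE) => h'; first by case: EA'; exact: seg_meet PMA' h' A'ME.
  by case: EA'; apply: (seg_meet h); rewrite // segC.
Qed.

Definition germ M Z l := forall C, s M Z C -> C <> M -> l C.

(** By trichotomy, the case to exclude is [Y'] between [Y] and [Z]. Then all of [s M Y] except [M]
    lies in [s Y Z] and has no last point, so by connectedness the rest of [s Y Z] is a closed
    segment from [Z] to some [N] in [l]. Now [M] and [N] close the same half-open segment from [Y],
    whence [M = N], although [M] is outside [l]. *)
Lemma germ_endpoint_between l M Y Z Y' : line_set s l -> ~ l M -> Y <> a M ->
  l Y -> germ M Y l -> l Z -> ~ s M Y Z ->
  s M Y Y' -> Y' <> M -> Y' <> Y -> s Y' Z Y.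
Proof.
move=> ll nM Ya lY g lZ nZ hY' Y'M Y'Y.
have YM : Y <> M by move=> e; apply: nM; rewrite -e.
have aMY : M <> a Y by move=> e; apply: Ya; rewrite e antipodeK.
case: (line_tri ll lY (g _ hY' Y'M) lZ) => // h.
  by case: nZ; apply: (seg_subr hY'); rewrite segC.
exfalso; have sub C : s M Y C -> C <> M -> s Y Z C.
  move=> hC CM; have lC := g _ hC CM.
  have [->//|CY'] := pselect (C = Y').
  case: (seg_cases hY' hC) => hC'; last first.
    by apply: seg_subl h _; rewrite segC.
  have CYY' : s C Y Y' by apply: seg_nest hY' hC'.
  case: (line_tri ll lC (g _ hY' Y'M) lZ) => h'.
  - case: nZ; apply: seg_subl hY' _; exact: convex_seg hC' (seg_endr s _ _) _ h'.
  (* Here [Y'] would separate each two of [C], [Y], [Z]. *)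
  - case: (line_cut3 ll (g _ hY' Y'M) lC lY lZ _ _ _ CYY' h' h) => //.
    + exact: nesym.
    + by move=> e; apply: nZ; rewrite e.
  - exact: seg_subr h h'.
have nZM : ~ s Y Z M by move=> h'; apply: nM; exact: ll.1 h'.
have Za : Z <> a Y := line_neq_antipode ll lY lZ.
have spl : convex_split s (s Y Z) (s M Y `\ M) (s Y Z `\` s M Y).
  split.
  - apply/seteqP; split=> [C hC|C [[h1 h2]|[]//]]; last exact: sub.
    have [hC'|] := pselect (s M Y C); last by right.
    by left; split=> // e; apply: nZM; rewrite -e.
  - by apply/seteqP; split=> // C [[h1 _] [_ h2]].
  - by split; [exists Y; split; [exact: seg_endr|]|exists Z; split; [exact: seg_endr|]].
  - split=> P Q [P1 P2] [Q1 Q2] C hC; split.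
    + exact: convex_seg P1 Q1 _ hC.
    + move=> e; move: hC; rewrite e => hC; apply: nM.
      by apply: ll.1 hC; [exact: g P1 P2|exact: g Q1 Q2].
    + exact: convex_seg P1 Q1 _ hC.
    + move=> hC'.
      have toY R S : s Y S R -> s R S C -> ~ s M Y R -> False.
        move=> YSR RSC; apply.
        apply: (convex_seg hC' (seg_endr s _ _)).
        by apply: (@seg_nest _ s S); rewrite segC.
      case: (seg_total P1 Q1) => h'; last exact: (toY P Q).
      by apply: (toY Q P) => //; rewrite segC.
have n1 : ~ is_segment s (s M Y `\ M).
  move=> hs; case: (@subsegment_endl _ s Y Z _ _ _ hs) => [|C [h1 h2]|D [hD DM] e].
  - by split; [exact: seg_endr|].
  - exact: sub.
  - have [E [h1 h2 h3]] := seg_dense Ya (seg_endl s _ _) hD (nesym DM).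
    have : (s M Y `\ M) E by split; [exact: seg_subl hD h1|].
    rewrite e segC => h4; apply: h3; exact: seg_meet hD h1 h4.
have [[]//|[_ hs]] := circle_connected hc Za spl.
case: (@subsegment_endl _ s Z Y _ _ _ hs) => [|C [h1 _]|N [N1 N2] e];
  [by split; [exact: seg_endr|]|by rewrite segC|].
have lN : l N by apply: ll.1 N1.
apply: nM; suff -> : M = N by [].
apply: (@open_end_unique Y) => //.
- exact: line_neq_antipode lN.
- by move=> e'; apply: N2; rewrite -e'; exact: seg_endr.
move=> C; split=> [[h1 h2]|[h1 h2]].
  rewrite segC in h1; split; last by move=> e'; apply: N2; rewrite -e'.
  case: (seg_cases N1 (sub _ h1 h2)) => //; rewrite segC -e => -[_ []//].
have YZC : s Y Z C := seg_subl N1 h1.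
have [hC|nC] := pselect (s M Y C).
  by rewrite segC; split=> // e'; apply: nZM; rewrite -e'.
have : (s Y Z `\` s M Y) C by split.
by rewrite e segC => h3; case: h2; exact: seg_meet N1 h1 h3.
Qed.

(* Two half-open segments ending at [Y], starting outside of [l] and arriving
   from opposite sides of [Y], exhaust [l]. *)
Lemma line_covered l M X Y U V : line_set s l -> ~ l M -> ~ l X ->
  Y <> a M -> Y <> a X -> l Y -> germ M Y l -> germ X Y l ->
  s M Y U -> U <> M -> U <> Y -> s X Y V -> V <> X -> V <> Y -> s U V Y ->
  forall Z, l Z -> s M Y Z \/ s X Y Z.
Proof.
move=> ll nM nX YaM YaX lY gM gX hU UM UY hV VX VY UVY Z lZ.
apply: contrapT => /not_orP[n1 n2].
apply: (line_cut3 ll lY (gM _ hU UM) (gX _ hV VX) lZ UY VY _ UVY).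
- by move=> e; apply: n1; rewrite e; exact: seg_endr.
- exact: (@germ_endpoint_between l M).
- exact: (@germ_endpoint_between l X).
Qed.

(* Otherwise both ends of the line [l] would converge to [M].  Splitting the
   circle at [X], one of the two resulting sides misses [M], hence is contained
   in [l] by [line_covered], although it contains [a M]. *)
Lemma germs_meet M l l' X Y : sides M l l' -> l X -> l Y ->
  germ M X l -> germ M Y l ->
  ~ (forall C, s M X C -> s M Y C -> C = M).
Proof.
move=> hl lX lY gX gY disj.
have ll := sides_line hl.
have nM : ~ l M by move=> h; exact: (side_neq hl h).
have naM : ~ l (a M) by move=> h; exact: (side_neq_antipode hl h).
have XM := side_neq hl lX; have YM := side_neq hl lY.
have XaM := side_neq_antipode hl lX; have YaM := side_neq_antipode hl lY.
have nYX : ~ s M Y X by move=> h; apply: XM; apply: disj => //; exact: seg_endr.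
have nXY : ~ s M X Y by move=> h; apply: YM; apply: disj => //; exact: seg_endr.
have XY : X <> Y by move=> e; apply: nXY; rewrite e; exact: seg_endr.
have btX X' : s M X X' -> X' <> M -> X' <> X -> s X' Y X.
  exact: (germ_endpoint_between ll).
have btY Y' : s M Y Y' -> Y' <> M -> Y' <> Y -> s Y' X Y.
  exact: (germ_endpoint_between ll).
have [X' [hX' X'M X'X]] := seg_dense XaM (seg_endl s _ _) (seg_endr s _ _) (nesym XM).
have [Y' [hY' Y'M Y'Y]] := seg_dense YaM (seg_endl s _ _) (seg_endr s _ _) (nesym YM).
have lX' := gX _ hX' X'M; have lY' := gY _ hY' Y'M.
have YaX : Y <> a X := line_neq_antipode ll lX lY.
have [b1 [b2 [hb b1X']]] : exists b1 b2, sides X b1 b2 /\ b1 X'.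
  have [b1 [b2 hb]] := sides_exist X.
  case: (sidesP hb X'X (line_neq_antipode ll lX lX')) => h; first by exists b1, b2.
  by exists b2, b1; split=> //; exact: sidesC.
have b2_of C : l C -> C <> X -> s X' C X -> b2 C.
  move=> lC CX h; case: (sidesP hb CX (line_neq_antipode ll lX lC)) => // b1C.
  by case: (side_neq hb (side_convex hb b1X' b1C h)).
have b2Y : b2 Y by apply: b2_of (nesym XY) (btX _ hX' X'M X'X).
have b1_of C : l C -> C <> X -> s C Y X -> b1 C.
  move=> lC CX h; case: (sidesP hb CX (line_neq_antipode ll lX lC)) => // b2C.
  by case: (side_neq (sidesC hb) (side_convex (sidesC hb) b2C b2Y h)).
have gMX C : s M X C -> C <> M -> C <> X -> b1 C.
  by move=> h CM CX; apply: b1_of => //; [exact: gX h CM|exact: btX].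
have gXY : germ X Y b2.
  move=> C h CX; apply: b2_of => //; first exact: ll.1 h.
  by rewrite segC; apply: (@seg_nest _ s Y); rewrite segC ?(segC _ Y) //; exact: btX.
have gMY : germ M Y b2.
  move=> C h CM; have lC := gY _ h CM.
  have CX : C <> X by move=> e; apply: nYX; rewrite -e.
  apply: b2_of => //.
  have [->|CY] := pselect (C = Y); first exact: btX.
  case: (line_cut_or ll lX lX' lY lC X'X (nesym XY) CX (btX _ hX' X'M X'X)) => // h'.
  by case: XY; apply: seg_anti (btY _ h CM CY) _; rewrite segC.
have aMM := @antipode_neq M.
case: (sidesP hb (nesym XM)) => [e|b1M|b2M].
- by apply: naM; rewrite e antipodeK.
(* The side [b2] misses [M]. It is exhausted by the segments reaching [Y] from [M] and from [X],
   neither of which contains [a M]. *)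
- have [V [hV VX VY]] := seg_dense YaX (seg_endl s _ _) (seg_endr s _ _) XY.
  case: (@line_covered b2 M X Y Y' V _ _ _ _ _ _ _ _ _ _ _ _ _ _ _ (a M)) => //.
  + exact: sides_line (sidesC hb).
  + exact (side_disj hb b1M).
  + by move=> h; exact: (side_neq (sidesC hb) h).
  + by rewrite segC; apply: seg_nest hV; rewrite segC; exact: btY.
  + exact: (side_antipode hb b1M).
  + by move=> h; exact: (naM (gY _ h aMM)).
  + by move=> h; exact: (naM (ll.1 _ _ lX lY _ h)).
(* Now [b1] misses [M], and the same argument applies to the segments reaching [X'] from [M] and
   from [X]. *)
- have hX : s X M X' by rewrite segC.
  have X'aM := side_neq_antipode hl lX'.
  have X'aX := line_neq_antipode ll lX lX'.
  have [U [hU UM UX']] := seg_dense X'aM (seg_endl s _ _) (seg_endr s _ _) (nesym X'M).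
  have [V [hV VX VX']] := seg_dense X'aX (seg_endl s _ _) (seg_endr s _ _) (nesym X'X).
  case: (@line_covered b1 M X X' U V _ _ _ _ _ _ _ _ _ _ _ _ _ _ _ (a M)) => //.
  + exact: sides_line hb.
  + by move=> h; exact: (side_disj hb h).
  + by move=> h; exact: (side_neq hb h).
  + move=> C h CM; apply: gMX => //; first exact: seg_subl h.
    by move=> e; apply: X'X; apply: (seg_anti _ hX'); rewrite -e.
  + move=> C h CX; apply: gMX => //; first by rewrite segC; exact: seg_subl h.
    by move=> e; apply: X'M; apply: (seg_anti _ hX); rewrite -e.
  + by rewrite segC; apply: seg_nest hV; rewrite segC; exact: seg_nest hX' hU.
  + exact: (side_antipode (sidesC hb) b2M).
  + by move=> h; exact: (naM (gX _ (seg_subl hX' h) aMM)).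
  + move=> h; apply: naM; apply: gX aMM; rewrite segC; exact: seg_subl hX h.
Qed.

(** If the segment meets the other side at [Z'], then its piece before [Z'] stays there: a point of
    it on the side of [Z] would, by convexity, bring [Z'] to that side too. *)
Lemma germ_side M l l' Z : sides M l l' -> Z <> M -> Z <> a M ->
  exists Z', [/\ s M Z Z', Z' <> M & germ M Z' l \/ germ M Z' l'].
Proof.
move=> hl ZM Za.
have key b b' : sides M b b' -> b Z ->
    exists Z', [/\ s M Z Z', Z' <> M & germ M Z' b \/ germ M Z' b'].
  move=> hb bZ; have [g|] := pselect (germ M Z b).
    by exists Z; split=> //; [exact: seg_endr|left].
  move=> /existsNP[Z'] /not_implyP[hZ'] /not_implyP[Z'M nZ'].
  have Z'a : Z' <> a M.
    move=> e; apply: (seg_no_antipodes Za (seg_endl s _ _)); rewrite -e; exact: hZ'.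
  exists Z'; split=> //; right=> C h CM.
  have Ca : C <> a M.
    move=> e; apply: (seg_no_antipodes Z'a (seg_endl s _ _)); rewrite -e; exact: h.
  case: (sidesP hb CM Ca) => // bC; case: nZ'.
  apply: side_convex hb _ _ _ bC bZ _; exact: seg_nest hZ' h.
case: (sidesP hl ZM Za) => h; first exact: key hl h.
have [Z' [h1 h2 h3]] := key _ _ (sidesC hl) h.
by exists Z'; split=> //; case: h3; [right|left].
Qed.

(* Two of the three germs would lie on the same side of [M]. *)
Lemma no_tripod M X Y Z : X <> M -> Y <> M -> Z <> M ->
  X <> a M -> Y <> a M -> Z <> a M ->
  (forall C, s M X C -> s M Y C -> C = M) ->
  (forall C, s M X C -> s M Z C -> C = M) ->
  (forall C, s M Y C -> s M Z C -> C = M) -> False.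
Proof.
move=> XM YM ZM Xa Ya Za XY XZ YZ.
have [l [l' hl]] := sides_exist M.
have [X' [hX X'M gX]] := germ_side hl XM Xa.
have [Y' [hY Y'M gY]] := germ_side hl YM Ya.
have [Z' [hZ Z'M gZ]] := germ_side hl ZM Za.
have XY' C : s M X' C -> s M Y' C -> C = M.
  by move=> h h'; apply: XY; [exact: seg_subl h|exact: seg_subl h'].
have XZ' C : s M X' C -> s M Z' C -> C = M.
  by move=> h h'; apply: XZ; [exact: seg_subl h|exact: seg_subl h'].
have YZ' C : s M Y' C -> s M Z' C -> C = M.
  by move=> h h'; apply: YZ; [exact: seg_subl h|exact: seg_subl h'].
have same P Q b b' : sides M b b' -> P <> M -> Q <> M -> germ M P b -> germ M Q b ->
    (forall C, s M P C -> s M Q C -> C = M) -> False.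
  move=> hb PM QM gP gQ.
  by apply: (germs_meet hb) => //; [apply: gP PM|apply: gQ QM]; exact: seg_endr.
have hl' := sidesC hl.
case: gX => gX; case: gY => gY; case: gZ => gZ.
- exact: (same X' Y' _ _ hl).
- exact: (same X' Y' _ _ hl).
- exact: (same X' Z' _ _ hl).
- exact: (same Y' Z' _ _ hl').
- exact: (same Y' Z' _ _ hl).
- exact: (same X' Z' _ _ hl').
- exact: (same X' Y' _ _ hl').
- exact: (same X' Y' _ _ hl').
Qed.

(** * Segments between and within the sides *)

(** Otherwise [l] and [l'] cut [s X Y] into two convex parts, and neither is a closed segment: at a
    last point [M] of one part, the two directions of the line through [M] and the direction of the
    rest of the segment would form a tripod. *)
Lemma seg_crosses A l l' X Y : sides A l l' -> l X -> l' Y -> Y <> a X ->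
  s X Y A \/ s X Y (a A).
Proof.
move=> hl lX l'Y Ya; apply: contrapT => /not_orP[nA naA].
have key b b' P Q : sides A b b' -> b P -> b' Q -> Q <> a P ->
    ~ s P Q A -> ~ s P Q (a A) -> ~ is_segment s (s P Q `&` b).
  move=> hb bP b'Q Qa n1 n2 hs.
  have bl := sides_line hb.
  case: (@subsegment_endl _ s P Q _ _ _ hs) => [|C []//|M [hM bM] e].
    by split=> //; exact: seg_endl.
  have [U [V [bU bV [UM VM hUV]]]] := line_between bl bM.
  have MQ : Q <> M by move=> e'; apply: (side_disj hb bM); rewrite -e'.
  have Qb' C : s M Q C -> C <> M -> ~ b C.
    move=> h CM bC; apply: CM.
    have : (s P Q `&` b) C by split=> //; exact: seg_subr h.
    by rewrite e => h'; exact: seg_meet hM h' h.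
  apply: (@no_tripod M U V Q) => //.
  - exact: line_neq_antipode bM bU.
  - exact: line_neq_antipode bM bV.
  - by move=> e'; apply: (seg_no_antipodes Qa hM); rewrite -e'; exact: seg_endr.
  - by move=> C h h'; apply: (seg_meet hUV); rewrite // segC.
  - move=> C h h'; apply: contrapT => CM; apply: Qb' h' CM _; exact: bl.1 h.
  - move=> C h h'; apply: contrapT => CM; apply: Qb' h' CM _; exact: bl.1 h.
have spl : convex_split s (s X Y) (s X Y `&` l) (s X Y `&` l').
  split.
  - apply/seteqP; split=> [C h|C [[]|[]]//].
    by case: (@sidesP _ _ _ hl C) => [e|e|h'|h'];
      [case: nA; rewrite -e|case: naA; rewrite -e|left|right].
  - by apply/seteqP; split=> // C [[_ h] [_ h']]; case: (side_disj hl h h').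
  - by split; [exists X|exists Y]; split=> //; [exact: seg_endl|exact: seg_endr].
  - split; apply: convexI; try exact: convex_seg.
      exact: (sides_line hl).1.
    exact: (sides_line (sidesC hl)).1.
have n1 := key _ _ _ _ hl lX l'Y Ya nA naA.
have n2 : ~ is_segment s (s X Y `&` l').
  rewrite segC; apply: (key _ _ _ _ (sidesC hl) l'Y lX); rewrite 1?segC //.
  by move=> e; apply: Ya; rewrite e antipodeK.
by have := circle_connected hc Ya spl; tauto.
Qed.

Lemma side_germ A l l' X : sides A l l' -> l X -> germ A X l.
Proof.
move=> hl lX C h CA.
have XA := side_neq_antipode hl lX.
have Ca : C <> a A.
  by move=> e; apply: (seg_no_antipodes XA (seg_endl s _ _)); rewrite -e.
case: (sidesP hl CA Ca) => // l'C.
have CX : C <> a X.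
  by move=> e; apply: (seg_no_antipodes XA (seg_endr s _ _)); rewrite -e.
case: (seg_crosses hl lX l'C CX) => h'.
  by case: CA; apply: (@seg_anti _ s X); rewrite // segC.
case: (seg_no_antipodes XA (seg_endl s _ _)).
by rewrite segC; apply: seg_subl h'; rewrite segC.
Qed.

(** If neither point is between [A] and the other, the two segments still share some [W] other than
    [A]. For [P] strictly between [A] and [W], the point [W] would separate each two of [P], [B],
    [D]. *)
Lemma side_total A l l' B D : sides A l l' -> l B -> l D -> s A B D \/ s A D B.
Proof.
move=> hl lB lD; apply: contrapT => /not_orP[n1 n2].
have ll := sides_line hl.
have gB := side_germ hl lB; have gD := side_germ hl lD.
apply: (germs_meet hl lB lD gB gD) => W hB hD; apply: contrapT => WA.
have between P : s A B P -> s A D P -> P <> A -> s B D P.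
  move=> h h' PA; case: (line_tri ll (gB _ h PA) lB lD) => h''; last by [].
    by case: n1; exact: seg_subr h h''.
  by case: n2; exact: seg_subr h' h''.
have WaA := side_neq_antipode hl (gB _ hB WA).
have [P [hP PA PW]] := seg_dense WaA (seg_endl s _ _) (seg_endr s _ _) (nesym WA).
have lW := gB _ hB WA; have hPB := seg_subl hB hP; have hPD := seg_subl hD hP.
apply: (line_cut3 ll lW (gB _ hPB PA) lB lD PW).
- by move=> e; apply: n2; rewrite e.
- by move=> e; apply: n1; rewrite e.
- exact: seg_nest hB hP.
- exact: seg_nest hD hP.
- exact: between.
Qed.

Lemma side_exists A B : B <> A -> B <> a A -> exists l l', sides A l l' /\ l B.
Proof.
move=> BA Ba; have [l [l' hl]] := sides_exist A.
case: (sidesP hl BA Ba) => h; first by exists l, l'.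
by exists l', l; split=> //; exact: sidesC.
Qed.

Lemma side_nonempty A l l' : sides A l l' -> exists X, l X.
Proof. by case=> -[_ _ [[X lX] _] _] _ _; exists X. Qed.

Lemma side_unbounded A l l' D : sides A l l' -> l D -> exists F, l F /\ ~ s A D F.
Proof.
move=> hl lD; have ll := sides_line hl.
have [P [Q [lP lQ [PD QD hPQ]]]] := line_between ll lD.
apply: contrapT => h.
have bounded F : l F -> s A D F.
  by move=> lF; apply: contrapT => nF; apply: h; exists F.
have [hP hQ] := (bounded _ lP, bounded _ lQ).
case: (seg_total hP hQ) => h'.
  by apply: PD; apply: (seg_anti _ hP); apply: (seg_subr h'); rewrite segC.
by apply: QD; apply: (seg_anti _ hQ); exact: (seg_subr h').
Qed.

(** * Maximal rays and the boundary at infinity *)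

Lemma side_ray A l l' : sides A l l' -> is_ray s A (A |` l).
Proof.
move=> hl; have ll := sides_line hl.
have gA P : (A |` l) P -> s A P `<=` A |` l.
  move=> [->|lP] C hC; first by left; rewrite seg_diag in hC.
  have [->|CA] := pselect (C = A); first by left.
  by right; exact: side_germ hl lP _ hC CA.
have inl P : (A |` l) P -> P <> A -> l P by move=> [].
have cvx : convex s (A |` l).
  move=> P Q hP hQ.
  have [->|PA] := pselect (P = A); first exact: gA.
  have [->|QA] := pselect (Q = A); first by rewrite segC; exact: gA.
  by move=> C hC; right; apply: ll.1 hC; exact: inl.
have ext B C : (A |` l) B -> (A |` l) C -> B <> A -> C <> A -> ~ s B C A.
  move=> hB hC BA CA h; apply: (side_neq hl _ erefl).
  by apply: ll.1 h; exact: inl.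
(* Three points lie in the segment from [A] to the farthest of them. *)
have max2 P Q : (A |` l) P -> (A |` l) Q ->
    exists M, [/\ (A |` l) M, s A M P & s A M Q].
  move=> hP hQ.
  have [->|PA] := pselect (P = A).
    by exists Q; split=> //; [exact: seg_endl|exact: seg_endr].
  have [->|QA] := pselect (Q = A).
    by exists P; split=> //; [exact: seg_endr|exact: seg_endl].
  case: (side_total hl (inl _ hP PA) (inl _ hQ QA)) => h.
    by exists P; split=> //; exact: seg_endr.
  by exists Q; split=> //; exact: seg_endr.
split=> //.
- by left.
- move=> P Q R hP hQ hR.
  have [M [hM MP MQ]] := max2 _ _ hP hQ.
  have [N [hN NM NR]] := max2 _ _ hM hR.
  exists A, N; split; last exact: gA.
  by move=> C /= [[->|->]|->] //; [exact: seg_subl NM MP|exact: seg_subl NM MQ].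
(* Extremality of [A] would make it an end of a closed segment equal to the ray, and the other end
   would bound the side. *)
- have noend D : (A |` l) D -> ~ A |` l `<=` s A D.
    move=> [->|lD] h.
      have [X lX] := side_nonempty hl; apply: (side_neq hl lX).
      by have := h X (or_intror lX); rewrite seg_diag.
    by have [F [lF nF]] := side_unbounded hl lD; apply: nF; apply: h; right.
  move=> [C [D e]].
  have hC : (A |` l) C by rewrite e; exact: seg_endl.
  have hD : (A |` l) D by rewrite e; exact: seg_endr.
  have hA : s C D A by rewrite -e; left.
  have [eC|CA] := pselect (C = A); first by apply: (noend D hD); rewrite e eC.
  have [eD|DA] := pselect (D = A); first by apply: (noend C hC); rewrite e eD segC.
  exact: ext hC hD CA DA hA.
Qed.

(** A ray is not the two-point segment [s B (a B)], so it has a third point. A segment containing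
    all three has neither antipodal ends, having more than two points, nor non-antipodal ends,
    containing an antipodal pair. *)
Lemma ray_no_antipodes A r B : is_ray s A r -> r B -> ~ r (a B).
Proof.
move=> hr rB raB.
have [C [rC CB CaB]] : exists C, [/\ r C, C <> B & C <> a B].
  apply: contrapT => h; apply: (ray_not_segment hr); exists B, (a B).
  apply/seteqP; split=> [C rC|]; last exact: (ray_convex hr rB raB).
  apply: contrapT => nC; apply: h; exists C; split=> // e; apply: nC; rewrite e.
    exact: seg_endl.
  exact: seg_endr.
have [D [E [h _]]] := ray_three hr rB raB rC.
have hB : s D E B by apply: h; left; left.
have haB : s D E (a B) by apply: h; left; right.
have hC : s D E C by apply: h; right.
have [e|/seg_no_antipodes/(_ hB)//] := pselect (E = a D).
move: hB hC; rewrite e => /seg_antipode[eB|eB] /seg_antipode[eC|eC].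
- by apply: CB; rewrite eB.
- by apply: CaB; rewrite eB.
- by apply: CaB; rewrite eB antipodeK.
- by apply: CB; rewrite eB.
Qed.

(** A ray meeting both sides would contain a segment through [A], against extremality, or through
    [a A], against the absence of antipodal pairs. *)
Lemma ray_in_side A l l' r : sides A l l' -> is_ray s A r ->
  r `<=` A |` l \/ r `<=` A |` l'.
Proof.
move=> hl hr; have rA := ray_origin hr.
have rP X : r X -> X <> A -> l X \/ l' X.
  move=> rX XA; apply: (sidesP hl XA) => e.
  by apply: (ray_no_antipodes hr rA); rewrite -e.
have [[Y [rY l'Y]]|nY] := pselect (exists Y, r Y /\ l' Y); last first.
  left=> X rX; have [->|XA] := pselect (X = A); first by left.
  by right; case: (rP _ rX XA) => // l'X; case: nY; exists X.
right=> X rX; have [->|XA] := pselect (X = A); first by left.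
right; case: (rP _ rX XA) => // lX; exfalso.
have Ya : Y <> a X by move=> e; apply: (ray_no_antipodes hr rX); rewrite -e.
case: (seg_crosses hl lX l'Y Ya) => h.
  exact: (ray_extreme hr rX rY XA (side_neq (sidesC hl) l'Y) h).
exact: (ray_no_antipodes hr rA (ray_convex hr rX rY h)).
Qed.

Lemma side_maximal_ray A l l' : sides A l l' -> is_maximal_ray s A (A |` l).
Proof.
move=> hl; split; first exact: side_ray hl.
move=> r hr [h nh]; case: (ray_in_side hl hr) => // h'.
have [X lX] := side_nonempty hl.
case: (h' X (h X (or_intror lX))) => [|l'X]; first exact (side_neq hl lX).
exact (side_disj hl lX l'X).
Qed.

Lemma maximal_rayP A l l' r : sides A l l' -> is_maximal_ray s A r ->
  r = A |` l \/ r = A |` l'.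
Proof.
move=> hl [hr mr].
have sub_eq r' : is_ray s A r' -> r `<=` r' -> r = r'.
  move=> hr' h; apply/seteqP; split=> //; apply: contrapT => h'.
  exact: (mr _ hr').
case: (ray_in_side hl hr) => h; [left|right]; apply: sub_eq => //.
  exact: side_ray hl.
exact: side_ray (sidesC hl).
Qed.

Lemma sides_antipodal_rays A l l' : sides A l l' ->
  antipodal_rays s A (A |` l) (A |` l').
Proof.
move=> hl; split; [exact: side_maximal_ray hl|exact: side_maximal_ray (sidesC hl)|].
have [X lX] := side_nonempty hl.
have AaX : A <> a X.
  by move=> e; apply: (side_neq_antipode hl lX); rewrite e antipodeK.
(* Cutting at [X] instead of [A] gives a line through [A], hence points [P], [Q] with [A] between
   them; they lie on different sides of [A]. *)
have [m [m' [hm mA]]] := side_exists (nesym (side_neq hl lX)) AaX.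
have lm := sides_line hm.
have [P [Q [mP mQ [PA QA h]]]] := line_between lm mA.
have Pa := line_neq_antipode lm mA mP; have Qa := line_neq_antipode lm mA mQ.
have same b b' : sides A b b' -> b P -> ~ b Q.
  by move=> hb bP bQ; exact: (side_neq hb (side_convex hb bP bQ h)).
have int B C : B <> A -> C <> A -> s B C A -> seg_interior s B C A.
  by move=> BA CA hA; split=> // -[]; exact: nesym.
case: (sidesP hl PA Pa) => hP; case: (sidesP hl QA Qa) => hQ.
- by case: (same _ _ hl hP).
- by exists P, Q; split; [right|right|exact: int].
- by exists Q, P; split; [right|right|apply: int; rewrite // segC].
- by case: (same _ _ (sidesC hl) hP).
Qed.

Lemma maximal_rays_antipodal A r1 r2 : is_maximal_ray s A r1 ->
  is_maximal_ray s A r2 -> r1 <> r2 -> antipodal_rays s A r1 r2.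
Proof.
move=> h1 h2 h; have [l [l' hl]] := sides_exist A.
case: (maximal_rayP hl h1) => e1; case: (maximal_rayP hl h2) => e2; subst r1 r2.
- by [].
- exact: sides_antipodal_rays.
- exact: sides_antipodal_rays (sidesC hl).
- by [].
Qed.

Lemma boundary_circle A : exactly_two (boundary_at_infinity s A).
Proof.
have [l [l' hl]] := sides_exist A; exists (A |` l), (A |` l'); split.
  have [X lX] := side_nonempty hl => e.
  have : (A |` l') X by rewrite -e; right.
  by move=> [|l'X]; [exact (side_neq hl lX)|exact (side_disj hl lX l'X)].
apply/seteqP; split=> [r [mr _]|r hr]; first exact: maximal_rayP hl mr.
have mr : is_maximal_ray s A r.
  by case: hr => ->; [exact: side_maximal_ray hl|exact: side_maximal_ray (sidesC hl)].
(* A segment inside a ray has non-antipodal ends, hence is connected. *)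
split=> // P Q h; apply: (circle_connected hc) => e.
apply: (@ray_no_antipodes A r P mr.1); first by apply: h; exact: seg_endl.
by apply: h; rewrite -e; exact: seg_endr.
Qed.

(** * The axioms of a spherical Pasch space *)

(** The common interior point forces [B] and [C] to the same side of [A], where segments from [A]
    are nested. *)
Lemma circle_common_interior A B C :
  seg_interior s A B `&` seg_interior s A C !=set0 ->
  s A B `<=` s A C \/ s A C `<=` s A B.
Proof.
have nondeg X W : s A X W -> ~ [set A; X] W -> [/\ X <> A, X <> a A & W <> A].
  move=> h nW; split=> e.
  - by apply: nW; left; move: h; rewrite e seg_diag.
  - by apply: nW; move: h; rewrite e => /seg_antipode.
  - by apply: nW; left.
move=> [W [[hB nB] [hC nC]]].
have [BA Ba WA] := nondeg _ _ hB nB; have [CA Ca _] := nondeg _ _ hC nC.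
have [l [l' [hl lB]]] := side_exists BA Ba.
have lW := side_germ hl lB hB WA.
case: (sidesP hl CA Ca) => hlC; last first.
  by case: (side_disj hl lW); exact: side_germ (sidesC hl) hlC _ hC WA.
case: (side_total hl lB hlC) => h; [right|left] => D hD; exact: seg_subl h hD.
Qed.

(* Two non-antipodal points lie on a common side of any point whose antipode
   is far enough from them. *)
Lemma circle_common_side A B : A <> B -> B <> a A ->
  exists E l l', [/\ sides E l l', l A & l B].
Proof.
move=> AB Ba; have [l [l' [hl lB]]] := side_exists (nesym AB) Ba.
have [F [lF nF]] := side_unbounded hl lB.
have l'E := side_antipode hl lF.
have AE : A <> a F by move=> e; exact: (side_neq (sidesC hl) l'E).
have AaE : A <> a (a F) by rewrite antipodeK => e; exact: (side_neq hl lF).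
have [m [m' [hm mA]]] := side_exists AE AaE.
exists (a F), m, m'; split=> //.
case: (@sidesP _ _ _ hm B) => //.
- by move=> e; apply: (side_disj hl lB); rewrite e.
- by rewrite antipodeK => e; apply: nF; rewrite e; exact: seg_endr.
- move=> m'B; case: (seg_crosses hm mA m'B Ba); rewrite ?antipodeK // => h.
  case: (side_disj hl (side_germ hl lB h (nesym AE))) => //.
Qed.

Lemma circle_segment_extension A B : A <> B -> connected_segment s (s A B) ->
  exists C D, connected_segment s (s C D) /\ s A B `<=` seg_interior s C D.
Proof.
move=> AB conn.
(* A segment joining antipodes is disconnected: it splits into two singletons, both closed
   segments. *)
have Ba : B <> a A.
  move=> e; rewrite e in AB conn.
  have spl : convex_split s (s A (a A)) (s A A) (s (a A) (a A)).
    split; last by split; exact: convex_seg.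
    - apply/seteqP; split=> [C /seg_antipode|C]; rewrite !seg_diag //.
      by move=> [->|->]; [exact: seg_endl|exact: seg_endr].
    - by apply/seteqP; split=> // C; rewrite !seg_diag => -[-> e'].
    - by split; [exists A|exists (a A)]; exact: seg_endl.
  have h1 : is_segment s (s A A) by exists A, A.
  have h2 : is_segment s (s (a A) (a A)) by exists (a A), (a A).
  by have := conn _ _ spl; tauto.
have [E [l [l' [hl lA lB]]]] := circle_common_side AB Ba.
have ll := sides_line hl.
have [C [lC CA hA]] := line_extend ll lA lB (nesym AB).
have [D [lD DB hB]] := line_extend ll lB lA AB.
have DA : D <> A by move=> e; move: hB; rewrite e seg_diag => e'; apply: AB.
have CB : C <> B by move=> e; move: hA; rewrite e seg_diag => e'; apply: AB.
have CDA : s C D A.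
  case: (line_cut_or ll lA lB lC lD (nesym AB) CA DA hA) => // h.
  by case: AB; apply: (@seg_anti _ s D); rewrite segC.
have CDB : s C D B.
  rewrite segC; case: (line_cut_or ll lB lA lD lC AB DB CB hB) => // h.
  by case: AB; apply: (@seg_anti _ s C); rewrite segC.
exists C, D; split.
  by apply: (circle_connected hc); exact: line_neq_antipode lC lD.
move=> X hX; split; first exact: convex_seg CDA CDB _ hX.
move=> [e|e]; move: hX; rewrite e => hX.
  by apply: CA; apply: (@seg_anti _ s B) => //; rewrite segC.
by apply: DB; exact: (@seg_anti _ s A).
Qed.

(** Cut at [X]: since [B] and [C] are on opposite sides, so are [a C] and [a B], and the segment
    joining these passes through [X] or [a X]. In the first case [B] and [a C] are nested as seen
    from [X], which puts an antipodal pair into [s B C] or into [s (a B) (a C)]. *)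
Lemma antipode_seg B C X : s B C X -> s (a B) (a C) (a X).
Proof.
move=> h.
have [->|XB] := pselect (X = B); first exact: seg_endl.
have [->|XC] := pselect (X = C); first exact: seg_endr.
have Ca : C <> a B.
  by move=> e; move: h; rewrite e => /seg_antipode[|e'] //; apply: XC; rewrite e.
have na Y : s B C Y -> Y <> a X.
  by move=> hY e; apply: (seg_no_antipodes Ca h); rewrite -e.
have [l [l' [hl lB]]] := side_exists (nesym XB) (na _ (seg_endl s _ _)).
have l'C : l' C.
  case: (sidesP hl (nesym XC) (na _ (seg_endr s _ _))) => // lC.
  by case: (side_neq hl (side_convex hl lB lC h)).
have laC := side_antipode (sidesC hl) l'C.
have aBC : a C <> a (a B) by rewrite antipodeK => e; apply: Ca; rewrite -e antipodeK.
have aCB : a B <> a (a C) by rewrite antipodeK; exact: nesym.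
case: (seg_crosses hl laC (side_antipode hl lB) aCB); rewrite segC // => hX.
exfalso; case: (side_total hl lB laC) => h'.
  apply: (seg_no_antipodes Ca (seg_endr s _ _)); apply: (seg_subl h).
  by rewrite segC.
by apply: (seg_no_antipodes aBC _ (seg_endl s _ _)); exact: seg_subr hX h'.
Qed.

(** Distinct maximal rays from [A] are antipodal, so the disjointness hypothesis forces [r1 = r2],
    and [C] itself is the required intersection point. *)
Lemma circle_pasch : pasch_condition s.
Proof.
move=> A r1 r2 r3 sub disj B C D [r1B _] [r1C _] _ _.
have in1 : [set r1; r2; r3] r1 by left; left.
have in2 : [set r1; r2; r3] r2 by left; right.
suff e : r1 = r2 by exists C; split; [rewrite -e|exact: seg_endl].
apply: contrapT => h; have [m1 _] := sub _ in1; have [m2 _] := sub _ in2.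
have : [set r1; r2; r3] `&`
    [set r' | exists2 r, [set r1; r2; r3] r & antipodal_rays s A r r'] `<=` set0.
  by rewrite disj.
by apply; split; [exact: in2|exists r1 => //; exact: maximal_rays_antipodal].
Qed.

Lemma circle_spherical_pasch : is_spherical_pasch_space s a.
Proof.
split.
- split; last exact: circle_pasch.
  by split; [exact: circle_common_interior|exact: circle_segment_extension].
- exact: antipodeK.
- exact: antipode_neq.
- move=> B C; apply/seteqP; split=> [Y [X hX <-]|Y hY]; first exact: antipode_seg.
  exists (a Y); last exact: antipodeK.
  by rewrite -(antipodeK B) -(antipodeK C); exact: antipode_seg.
- exact: circle_connected hc.
- by move=> A B <-; rewrite segC; exact: circle_antipodal hc B.
- move=> A r1 r2 m1 m2 [B [hB haB]]; apply: maximal_rays_antipodal => // e.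
  move: hB haB; rewrite -e setUid; exact: ray_no_antipodes m1.1.
Qed.

End Circle.

Theorem corollary13p7 (T : Type) (s : betweenness T) (a : T -> T)
    (hc : is_circle s a) :
  is_spherical_pasch_space s a /\
  forall A : T, exactly_two (boundary_at_infinity s A).
Proof.
by split; [exact: circle_spherical_pasch|exact: boundary_circle hc].
Qed.
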